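(* Let $q>p\geq1$ be integers, $G=\mathbf{SO}_0(p,q)$, $K=\mathbf{SO}(p)\times\mathbf{SO}(q)$, and let $X,Y\in\mathfrak{a}$ have configurations $[\mathbf{s};u]$ and $[\mathbf{t};v]$ respectively. If $X$ and $Y$ are eligible, i.e. if $\max(\mathbf{s},2u)+\max(\mathbf{t},2v)\leq 2p$, then there exists a matrix $k\in K$ such that $$V_X+\mathrm{Ad}(k)\,V_Y=\mathfrak{p}.$$
   Context: $\mathbf{SO}_0(p,q)$ is the identity component of $\{g\in\mathbf{SL}(p+q,\mathbf{R}): g^TI_{p,q}g=I_{p,q}\}$, $I_{p,q}=\mathrm{diag}(-I_p,I_q)$, with Lie algebra $\mathfrak{g}=\mathfrak{so}(p,q)$. $K\simeq\mathbf{SO}(p)\times\mathbf{SO}(q)$ is the subgroup of block-diagonal matrices, with Lie algebra $\mathfrak{k}$. The Cartan involution is $\theta(X)=-X^T$, and $\mathfrak{g}=\mathfrak{k}\oplus\mathfrak{p}$ where $\mathfrak{p}=\left\{\begin{pmatrix}0&B\\ B^T&0\end{pmatrix}: B\in\mathbf{R}^{p\times q}\right\}$. The Cartan subspace $\mathfrak{a}\subset\mathfrak{p}$ is the set of elements $H$ for which $B=[\mathcal{D}_H\ \ 0_{p\times(q-p)}]$ with $\mathcal{D}_H=\mathrm{diag}[H_1,\dots,H_p]$. The restricted roots of $(\mathfrak{g},\mathfrak{a})$ are $\pm H_i$ ($1\le i\le p$, multiplicity $q-p$) and $\pm H_i\pm H_j$ ($1\le i<j\le p$, multiplicity 1); the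 root space of $\alpha$ is $\mathfrak{g}_\alpha=\{W\in\mathfrak{g}:[H,W]=\alpha(H)W\ \forall H\in\mathfrak{a}\}$. For $Z\in\mathfrak{a}$, $V_Z=\mathrm{span}\{X_\alpha-\theta X_\alpha : X_\alpha\in\mathfrak{g}_\alpha,\ \alpha \text{ a root with } \alpha(Z)\neq0\}\subset\mathfrak{p}$. Configuration: for $X\in\mathfrak{a}$, list the absolute values of the diagonal entries of $\mathcal{D}_X$ in decreasing order as $x_1$ repeated $s_1$ times, ..., $x_r$ repeated $s_r$ times, and $0$ repeated $u\ge0$ times, where $x_1>\dots>x_r>0$, $s_i\geq1$, and $\sum s_i+u=p$. Then $[\mathbf{s};u]=[s_1,\dots,s_r;u]$ is the configuration of $X$ (for $X=0$ it is $[0;p]$). For an integer $m$, $\max(\mathbf{s},m)=\max(\max_i s_i,m)$. *)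

(* Defs.v *)
From HB Require Import structures.
From mathcomp Require Import all_boot all_order all_algebra.
From mathcomp Require Import boolp classical_sets reals.

Set Implicit Arguments.
Unset Strict Implicit.
Unset Printing Implicit Defensive.

Import Order.TTheory GRing.Theory Num.Theory.

Local Open Scope classical_set_scope.
Local Open Scope ring_scope.

(* Matrices of size p + q are written in blocks of sizes p and q; sets of
   matrices (Lie algebras, subspaces, groups) are [set 'M[R]_(p + q)]. *)

Definition Ipq (R : realType) (p q : nat) : 'M[R]_(p + q) :=
  block_mx (- 1%:M) 0 0 1%:M.

(* The Lie algebra of SO_0(p, q), obtained by differentiating
   g^T I_{p,q} g = I_{p,q} at the identity; this equation forces trace 0. *)
Definition so (R : realType) (p q : nat) : set 'M[R]_(p + q) :=
  [set W | W^T *m Ipq R p q + Ipq R p q *m W = 0].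

Definition SO (R : realType) (n : nat) : set 'M[R]_n :=
  [set A | A^T *m A = 1%:M /\ \det A = 1].

Definition Kpq (R : realType) (p q : nat) : set 'M[R]_(p + q) :=
  [set k | exists A D, [/\ SO A, SO D & k = block_mx A 0 0 D]].

Definition Ad (R : realType) (n : nat) (k W : 'M[R]_n) : 'M[R]_n :=
  k *m W *m invmx k.

Definition bracket (R : realType) (n : nat) (U W : 'M[R]_n) : 'M[R]_n :=
  U *m W - W *m U.

Definition theta (R : realType) (n : nat) (W : 'M[R]_n) : 'M[R]_n := - W^T.

Definition pmx (R : realType) (p q : nat) (B : 'M[R]_(p, q)) : 'M[R]_(p + q) :=
  block_mx 0 B B^T 0.

Definition pspace (R : realType) (p q : nat) : set 'M[R]_(p + q) :=
  range (@pmx R p q).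
Arguments pspace R p q _ : clear implicits.

(* When p <= q, the Cartan subspace a is the range of [amx], and an element of
   a is represented by its diagonal (H_1, ..., H_p) : 'rV_p. The matrix B below
   is the block matrix [diag(H_1, ..., H_p)  0_{p x (q - p)}]. *)
Definition amx (R : realType) (p q : nat) (H : 'rV[R]_p) : 'M[R]_(p + q) :=
  pmx (\matrix_(i < p, j < q) (if i == j :> nat then H 0 i else 0)).

Definition root_space (R : realType) (p q : nat) (alpha : {scalar 'rV[R]_p}) :
    set 'M[R]_(p + q) :=
  [set W | so W /\
           forall H : 'rV[R]_p, bracket (amx q H) W = alpha H *: W].
Arguments root_space {R p} q alpha _.

Definition restricted_root (R : realType) (p q : nat)
    (alpha : {scalar 'rV[R]_p}) : Prop :=
  (exists H, alpha H != 0) /\ (exists2 W, root_space q alpha W & W != 0).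

Definition lin_span (R : realType) (V : vectType R) (S : set V) : set V :=
  [set v | exists2 s : seq V, (forall w, w \in s -> S w) & v \in <<s>>%VS].

Definition set_add (R : realType) (V : vectType R) (S T : set V) : set V :=
  [set v + w | v in S & w in T].

Definition VZ (R : realType) (p q : nat) (Z : 'rV[R]_p) : set 'M[R]_(p + q) :=
  lin_span [set U | exists alpha W,
    [/\ restricted_root q alpha, alpha Z != 0, root_space q alpha W &
        U = W - theta W]].
Arguments VZ {R p} q Z _.

Definition abs_entries (R : realType) (p : nat) (X : 'rV[R]_p) : seq R :=
  sort >=%R [seq `|X 0 i| | i <- enum 'I_p].

(* [undup] keeps the order of the sorted list, so the first component lists the
   multiplicities of x_1 > ... > x_r > 0. *)
Definition configuration (R : realType) (p : nat) (X : 'rV[R]_p) :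
    seq nat * nat :=
  let l := abs_entries X in
  let x := undup [seq a <- l | 0 < a] in
  (if nilp x then [:: 0%N] else [seq count_mem a l | a <- x], count_mem 0 l).

Definition max_conf (s : seq nat) (m : nat) : nat := maxn (\max_(i <- s) i) m.

Definition eligible (p : nat) (cX cY : seq nat * nat) : bool :=
  (max_conf cX.1 (2 * cX.2) + max_conf cY.1 (2 * cY.2) <= 2 * p)%N.

(* Main.v *)
Require Import Defs.
From HB Require Import structures.
From mathcomp Require Import all_boot all_order all_algebra.
From mathcomp Require Import boolp classical_sets reals.
From mathcomp Require Import ring lra zify.

(* Write B for the element [pmx B] of p. Under the trace form the orthogonal of
   V_Z in p is the centralizer of Z in p, so it suffices to find orthogonal A
   and D such that no nonzero B centralizes X while A^T B D centralizes Y.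
   Assume u <= v (the condition is symmetric) and let w = p - v be the number of
   nonzero entries of Y. If A^T B D centralizes Y then there are orthonormal
   families e_1, ..., e_w of R^p and f_1, ..., f_w of R^q, read off the columns
   of A and D, and a symmetric T such that B f_l = sum_k T_kl e_k and
   B^T e_k = sum_l T_kl f_l. Eligibility gives s_i <= 2 w and u <= w <= p - u.
   List the nonzero coordinates of X by increasing absolute value, at positions
   0, 1, ..., so that a level set of |X| meets each residue class mod 2 w at most
   once. Each residue below w is given to one e_k, each other residue to one f_l;
   every e_k and f_k with k < u also receives one of the u zero coordinates, with
   a larger weight for f; f_u receives a coordinate beyond p (this is where q > p
   enters), and f_(k+1) shares position k with e_k for u <= k. On the zero level
   the weights of e and f differ, which kills the rows k <= u of T; the shared
   positions then propagate the vanishing to all rows; and once T = 0 the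
   distribution of the residues forces B = 0. *)

Set Implicit Arguments.
Unset Strict Implicit.
Unset Printing Implicit Defensive.

Import Order.TTheory GRing.Theory Num.Theory.

Local Open Scope classical_set_scope.
Local Open Scope ring_scope.

(** * Numbering of coordinates by increasing value *)

(** After sorting by [a], a level set fills an interval of at most [m] consecutive positions, so it
    meets each residue class modulo [m] at most once. *)
Lemma sorted_positions (R : realType) (p m : nat) (a : 'I_p -> R)
    (S : {set 'I_p}) :
  (forall i, i \in S -> (#|[set j in S | a j == a i]| <= m)%N) ->
  exists pos : 'I_p -> nat,
    [/\ {in S &, injective pos},
        forall i, i \in S -> (pos i < #|S|)%N,
        forall k, (k < #|S|)%N -> exists2 i, i \in S & pos i = k
      & {in S &, forall i j, a i = a j -> pos i = pos j %[mod m] -> i = j}].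
Proof.
move=> hm.
pose r : rel 'I_p := fun i j => a i <= a j.
have r_tot : total r by move=> i j; exact: le_total.
have r_tr : transitive r by move=> i j k; exact: le_trans.
pose L := sort r (enum S).
have memL i : (i \in L) = (i \in S) by rewrite mem_sort mem_enum.
have uL : uniq L by rewrite sort_uniq enum_uniq.
have sL : size L = #|S| by rewrite size_sort -cardE.
have srt : sorted r L by apply: sort_sorted.
have inj : {in S &, injective (fun i => index i L)}.
  by move=> i j iS jS; apply: index_inj; rewrite ?memL.
exists (fun i => index i L); split=> //.
- by move=> i iS; rewrite -sL index_mem memL.
- move=> k; rewrite -sL => kL.
  have /card_gt0P[i0 _] : (0 < #|S|)%N by rewrite -sL (leq_ltn_trans _ kL).
  by exists (nth i0 L k); rewrite ?index_uniq // -memL mem_nth.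
- move=> i j iS jS.
  wlog le_ij : i j iS jS / (index i L <= index j L)%N.
    move=> H aij e; case: (leqP (index i L) (index j L)) => [|/ltnW] le.
      exact: H.
    by apply/esym/H.
  move=> aij e; apply: inj => //.
  (* Sortedness squeezes every value lying between two equal ones. *)
  have between t : (index i L <= t <= index j L)%N -> a (nth i L t) = a i.
    move=> /andP[it tj].
    have jL : (index j L < size L)%N by rewrite index_mem memL.
    have tL : (t < size L)%N by apply: leq_ltn_trans jL.
    apply/eqP; rewrite eq_le; apply/andP; split.
      have := sorted_leq_nth r_tr (fun x => lexx (a x)) i srt _ _ tL jL tj.
      by rewrite nth_index ?memL // /r -aij.
    have iL : (index i L < size L)%N by rewrite index_mem memL.
    have := sorted_leq_nth r_tr (fun x => lexx (a x)) i srt _ _ iL tL it.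
    by rewrite nth_index ?memL.
  (* The entries from position [index i L] through [index j L] are distinct members of a single
     level set, which has at most [m] elements. *)
  have lt : (index j L - index i L < m)%N.
    apply: leq_trans (hm _ iS).
    rewrite cardE.
    set d := (_ - _).+1.
    have -> : d = size [seq nth i L t | t <- iota (index i L) d].
      by rewrite size_map size_iota.
    apply: uniq_leq_size.
      rewrite map_inj_in_uniq ?iota_uniq // => x y.
      rewrite !mem_iota /d => hx hy /eqP.
      have jL : (index j L < size L)%N by rewrite index_mem memL.
      have xL : (x < size L)%N by lia.
      have yL : (y < size L)%N by lia.
      by rewrite nth_uniq // => /eqP.
    move=> x /mapP[t]; rewrite mem_iota /d => ht ->.
    have jL : (index j L < size L)%N by rewrite index_mem memL.
    have tL : (t < size L)%N by lia.
    by rewrite mem_enum inE -memL mem_nth // between ?eqxx //; lia.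
  apply/eqP; rewrite eqn_leq le_ij /= -subn_eq0.
  have : (m %| index j L - index i L)%N by rewrite -eqn_mod_dvd //; apply/eqP.
  by case: (index j L - index i L)%N lt => // n lt /dvdn_leq /=; lia.
Qed.

(** * Restriction of the frame equations to a level set *)

(* The shape of a matrix [row_mx B C] centralizing X, for a = |X|, once the signs
   of the entries of X have been absorbed into the rows. *)
Definition block_sym (R : realType) (p d : nat) (a : 'I_p -> R)
    (B : 'M[R]_p) (C : 'M[R]_(p, d)) : Prop :=
  [/\ forall i j, a i != a j -> B i j = 0,
      forall i j, a i != 0 -> B i j = B j i
    & forall i j, a i != 0 -> C i j = 0].

(** Placed between two frames, this projector gives the scalar products of their restrictions to the
    level [c]. *)
Definition level_mx (R : realType) (p : nat) (a : 'I_p -> R) (c : R) : 'M[R]_p :=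
  diag_mx (\row_i (a i == c)%:R).

Lemma level_mx_entry (R : realType) (p m n : nat) (a : 'I_p -> R) (c : R)
    (E : 'M[R]_(m, p)) (F : 'M[R]_(n, p)) k l :
  (E *m level_mx a c *m F^T) k l = \sum_(i | a i == c) E k i * F l i.
Proof.
rewrite /level_mx mul_mx_diag !mxE [RHS]big_mkcond /=.
by apply: eq_bigr => i _; rewrite !mxE; case: eqP; rewrite ?mulr1 // mulr0 mul0r.
Qed.

(** The projector onto the zero level commutes with [B] and fixes [C], so [(F *m B^T + G *m C^T) *m
    level_mx a 0 *m E^T] can be evaluated from either end. The identity compares the weights of the
    two frames on the zero level, coordinates beyond [p] counting as zeros. *)
Lemma block_sym_zero_level (R : realType) (p d w : nat) (a : 'I_p -> R)
    (B : 'M[R]_p) (C : 'M[R]_(p, d)) (E F : 'M[R]_(w, p)) (G : 'M[R]_(w, d))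
    (T : 'M[R]_w) :
  block_sym a B C -> T^T = T -> B *m F^T + C *m G^T = E^T *m T ->
  E *m B = T *m F -> E *m C = T *m G ->
  T *m (E *m level_mx a 0 *m E^T) =
  (F *m level_mx a 0 *m F^T + G *m G^T) *m T.
Proof.
move=> [hB _ hC] hT h1 h2 h3.
have hB0 : level_mx a 0 *m B = B *m level_mx a 0.
  rewrite /level_mx mul_diag_mx mul_mx_diag; apply/matrixP => i j; rewrite !mxE.
  have [->|/hB ->] := eqVneq (a i) (a j); first by rewrite mulrC.
  by rewrite mulr0 mul0r.
have hC0 : level_mx a 0 *m C = C.
  rewrite /level_mx mul_diag_mx; apply/matrixP => i j; rewrite !mxE.
  by have [_|/hC ->] := eqVneq (a i) 0; rewrite ?mul1r // mulr0.
have -> : T *m (E *m level_mx a 0 *m E^T) =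
    (F *m B^T + G *m C^T) *m level_mx a 0 *m E^T.
  have -> : F *m B^T + G *m C^T = T *m E.
    apply: trmx_inj; rewrite linearD /= !trmx_mul !trmxK h1.
    by rewrite hT.
  by rewrite !mulmxA.
have hL : (level_mx a 0)^T = level_mx a 0 by rewrite tr_diag_mx.
have hB0' : B^T *m level_mx a 0 = level_mx a 0 *m B^T.
  by apply: trmx_inj; rewrite !trmx_mul trmxK hL hB0.
have hC0' : C^T *m level_mx a 0 = C^T.
  by apply: trmx_inj; rewrite !trmx_mul trmxK hL hC0.
have h2' : B^T *m E^T = F^T *m T.
  by apply: trmx_inj; rewrite !trmx_mul !trmxK h2 hT.
have h3' : C^T *m E^T = G^T *m T.
  by apply: trmx_inj; rewrite !trmx_mul !trmxK h3 hT.
rewrite !mulmxDl -!mulmxA (mulmxA B^T) hB0' (mulmxA C^T) hC0' h3'.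
by rewrite -!mulmxA h2'.
Qed.

(** On a nonzero level [B] is symmetric, hence [B *m level_mx a c = level_mx a c *m B^T], and both
    sides equal [E *m B *m level_mx a c *m E^T]. *)
Lemma block_sym_level (R : realType) (p d w : nat) (a : 'I_p -> R)
    (B : 'M[R]_p) (C : 'M[R]_(p, d)) (E F : 'M[R]_(w, p)) (T : 'M[R]_w) (c : R) :
  block_sym a B C -> c != 0 -> T^T = T -> E *m B = T *m F ->
  T *m (E *m level_mx a c *m F^T)^T = E *m level_mx a c *m F^T *m T.
Proof.
move=> [hB hS _] c0 hT h2.
have hL : (level_mx a c)^T = level_mx a c by rewrite tr_diag_mx.
have hBc : B *m level_mx a c = level_mx a c *m B^T.
  rewrite /level_mx mul_diag_mx mul_mx_diag; apply/matrixP => i j; rewrite !mxE.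
  have [aij|aij] := eqVneq (a i) (a j).
    rewrite aij; have [ac|_] := eqVneq (a j) c; last by rewrite mulr0 mul0r.
    by rewrite mulrC (hS i j) // aij ac.
  by rewrite (hB _ _ aij) (hB j i) 1?eq_sym // mulr0 mul0r.
have h2' : B^T *m E^T = F^T *m T.
  by apply: trmx_inj; rewrite !trmx_mul !trmxK h2 hT.
rewrite !trmx_mul trmxK hL !mulmxA -h2 -(mulmxA E B) hBc.
by rewrite -!mulmxA h2'.
Qed.

(** * Construction of the two frames *)

Lemma normalized_rows (R : realType) (w p : nat) (e : 'I_w -> 'I_p -> R) :
  (forall k l, k != l -> \sum_i e k i * e l i = 0) ->
  (forall k, 0 < \sum_i e k i ^+ 2) ->
  let E := \matrix_(k, i) (e k i / Num.sqrt (\sum_j e k j ^+ 2)) in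
  E *m E^T = 1%:M.
Proof.
move=> h0 h1 E; apply/matrixP => k l; rewrite !mxE.
set N := fun k => \sum_j e k j ^+ 2.
transitivity ((\sum_i e k i * e l i) / (Num.sqrt (N k) * Num.sqrt (N l))).
  rewrite mulr_suml; apply: eq_bigr => i _.
  by rewrite !mxE invfM; ring.
have [<-|kl] := eqVneq k l; last by rewrite h0 // mul0r.
rewrite -expr2 sqr_sqrtr ?ltW ?h1 //.
under eq_bigr do rewrite -expr2.
by rewrite divff // gt_eqF // h1.
Qed.

(** Zero and nonzero coordinates are numbered separately by [pos]. The rows of [E] are the [e_k] and
    those of [row_mx F G] are the [f_k]; within each family the supports are disjoint, so
    orthogonality is automatic and only the norms matter. *)
Lemma frames_of_positions (R : realType) (p d w u : nat) (a : 'I_p -> R)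
    (pos : 'I_p -> nat) :
  (0 < w)%N -> (u <= w)%N ->
  (forall i, a i = 0 -> (pos i < u)%N) ->
  (forall i j, a i = 0 -> a j = 0 -> pos i = pos j -> i = j) ->
  (forall k, (k < u)%N -> exists2 i, a i = 0 & pos i = k) ->
  (forall i j, a i != 0 -> a j != 0 -> pos i = pos j -> i = j) ->
  (forall k, (k < w)%N -> exists2 i, a i != 0 & pos i = k) ->
  (forall i j, a i != 0 -> a i = a j -> pos i = pos j %[mod 2 * w] -> i = j) ->
  exists (E F : 'M[R]_(w, p)) (G : 'M[R]_(w, d.+1)),
    [/\ E *m E^T = 1%:M, F *m F^T + G *m G^T = 1%:M &
     forall B C T, block_sym a B C -> T^T = T ->
       B *m F^T + C *m G^T = E^T *m T -> E *m B = T *m F -> E *m C = T *m G ->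
       B = 0 /\ C = 0].
Proof.
move=> w_gt0 le_uw zlt zinj zsurj ninj nsurj nmod.
pose r i := (pos i %% (2 * w))%N.
(* Coordinate i belongs to e_(kap i) and to f_(phi i); an index that is not below
   w means that i belongs to none. *)
pose kap i := if a i == 0 then pos i else r i.
pose phi i := if a i == 0 then pos i else if (w <= r i)%N then (r i - w)%N
  else if (u <= pos i < w)%N then (pos i).+1 else w.
(* The value [p.+1] is chosen so that its square exceeds [p], a bound for any sum of unit weights
   over the coordinates. *)
pose wt i : R := if (a i != 0) && (w <= r i)%N then 1 else p.+1%:R.
pose e (k : 'I_w) i : R := (kap i == k)%:R.
pose f1 (k : 'I_w) i : R := (phi i == k)%:R * wt i.
(* No zero coordinate has position [u], so [f_u] takes its large weight from the first coordinate
   beyond [p]. *)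
pose f2 (k : 'I_w) (c : 'I_d.+1) : R :=
  ((c == ord0) && (k == u :> nat))%:R * p.+1%:R.
pose f k i := match split i with inl i => f1 k i | inr c => f2 k c end.
have fl k i : f k (lshift d.+1 i) = f1 k i.
  by rewrite /f -[lshift _ _]/(unsplit (inl i)) unsplitK.
have fr k c : f k (rshift p c) = f2 k c.
  by rewrite /f -[rshift _ _]/(unsplit (inr c)) unsplitK.
have p1gt0 : 0 < p.+1%:R :> R by rewrite ltr0n.
have wt_gt0 i : 0 < wt i by rewrite /wt; case: ifP.
have r_small i : (pos i < w)%N -> r i = pos i by move=> ?; rewrite /r modn_small //; lia.
pose N k := \sum_i e k i ^+ 2.
pose M k := \sum_i f k i ^+ 2.
have e0 k l i : k != l -> e k i * e l i = 0.
  rewrite /e => kl; case: eqP => [->|]; last by rewrite mul0r.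
  by rewrite (inj_eq val_inj) (negbTE kl) mulr0.
have f10 k l i : k != l -> f1 k i * f1 l i = 0.
  rewrite /f1 => kl; case: eqP => [->|]; last by rewrite !mul0r.
  by rewrite (inj_eq val_inj) (negbTE kl) mul0r mulr0.
have f20 k l c : k != l -> f2 k c * f2 l c = 0.
  rewrite /f2 => kl; case: (c == ord0); last by rewrite !mul0r.
  rewrite /=; case: eqP => [ku|]; last by rewrite !mul0r.
  by rewrite -ku eq_sym (inj_eq val_inj) (negbTE kl) mul0r mulr0.
have MD k : M k = \sum_i f1 k i ^+ 2 + \sum_c f2 k c ^+ 2.
  rewrite /M big_split_ord /=; congr (_ + _).
    by apply: eq_bigr => i _; rewrite fl.
  by apply: eq_bigr => i _; rewrite fr.
have N_gt0 k : 0 < N k.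
  have [i ai pi] := nsurj k (ltn_ord k).
  rewrite /N (bigD1 i) //= ltr_pwDl //; last by apply: sumr_ge0 => j _; exact: sqr_ge0.
  by rewrite /e /kap (negbTE ai) r_small ?pi // eqxx expr1n.
have sum_ge (n : nat) (P : pred 'I_n) (g : 'I_n -> R) i :
    P i -> \sum_(j | P j) g j ^+ 2 >= g i ^+ 2.
  by move=> Pi; rewrite (bigD1 i) //= lerDl sumr_ge0 // => j _; exact: sqr_ge0.
have sum_sq_ge0 (n : nat) (P : pred 'I_n) (g : 'I_n -> R) :
    0 <= \sum_(j | P j) g j ^+ 2.
  by apply: sumr_ge0 => j _; exact: sqr_ge0.
pose num k := \sum_(i | a i == 0) f1 k i ^+ 2 + \sum_c f2 k c ^+ 2.
have num_ge (k : 'I_w) : (k <= u)%N -> p.+1%:R ^+ 2 <= num k.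
  rewrite leq_eqVlt => /orP[/eqP ku|ku].
    have h : f2 k ord0 = p.+1%:R by rewrite /f2 eqxx ku eqxx mul1r.
    rewrite /num -h addrC; apply: ler_wpDr => //.
    exact: (sum_ge _ predT).
  have [i ai pi] := zsurj _ ku.
  have h : f1 k i = p.+1%:R by rewrite /f1 /phi /wt ai eqxx pi eqxx mul1r.
  rewrite /num -h; apply: ler_wpDr => //.
  by apply: (sum_ge _ (fun i => a i == 0)); rewrite ai.
have M_num k : M k = num k + \sum_(i | a i != 0) f1 k i ^+ 2.
  by rewrite MD (bigID (fun i => a i == 0)) /= /num; ring.
(* Shared positions only serve rows [k > u]; for [k <= u] the nonzero coordinates of [f_k] have
   weight 1 and contribute at most [p]. So more than half of the squared norm lies on the zero
   level. *)
have M_lt (k : 'I_w) : (k <= u)%N -> M k < 2 * num k.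
  move=> ku; rewrite M_num; have kw := ltn_ord k.
  have h : \sum_(i | a i != 0) f1 k i ^+ 2 <= p%:R.
    apply: (@le_trans _ _ (\sum_(i < p) 1)); last by rewrite sumr_const card_ord.
    rewrite big_mkcond; apply: ler_sum => i _; case: ifP => // ai.
    rewrite /f1 /phi /wt ai (negbTE ai) /=; case: (leqP w (r i)) => [_|rw].
      by case: eqP => _; rewrite mulr1 ?expr1n ?expr0n ?lexx ?ler01.
    case: ifP => [/andP[up pw]|_].
      by rewrite (_ : (_ == _) = false) ?mul0r ?expr0n ?ler01 //; lia.
    by rewrite (_ : (_ == _) = false) ?mul0r ?expr0n ?ler01 //; lia.
  have := num_ge _ ku.
  have : (p%:R : R) < p.+1%:R ^+ 2 by rewrite -natrX ltr_nat; lia.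
  lra.
have M_gt0 k : 0 < M k.
  case: (leqP k u) => ku.
    have := num_ge _ ku; rewrite M_num.
    have : 0 < p.+1%:R ^+ 2 :> R by rewrite exprn_gt0.
    have := sum_sq_ge0 _ (fun i => a i != 0) (f1 k).
    lra.
  have kw := ltn_ord k.
  have [|i ai pi] := nsurj k.-1; first by lia.
  have h : f1 k i = p.+1%:R.
    rewrite /f1 /phi /wt ai (negbTE ai) r_small ?pi; last by lia.
    have -> : (w <= k.-1)%N = false by lia.
    have -> : (u <= k.-1 < w)%N by lia.
    by rewrite prednK ?eqxx ?mul1r //; lia.
  have := sum_ge _ (fun i => a i != 0) (f1 k) i ai.
  have : 0 < p.+1%:R ^+ 2 :> R by rewrite exprn_gt0.
  have : 0 <= num k by rewrite addr_ge0.
  rewrite M_num h; lra.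
(* All weights of [e_k] are 1, with at most one zero coordinate and at least one nonzero one, so at
   most half of the squared norm lies on the zero level. *)
have N_ge k : 2 * (\sum_(i | a i == 0) e k i ^+ 2) <= N k.
  have h1 : 1 <= \sum_(i | a i != 0) e k i ^+ 2.
    have [i ai pi] := nsurj k (ltn_ord k).
    have h : e k i = 1 by rewrite /e /kap (negbTE ai) r_small ?pi // eqxx.
    by have := sum_ge _ (fun i => a i != 0) (e k) i ai; rewrite h expr1n.
  have h2 : \sum_(i | a i == 0) e k i ^+ 2 <= 1.
    case: (pickP (fun i => (a i == 0) && (kap i == k))) => [i0 /andP[ai0 ki0]|none].
      rewrite (bigD1 i0) //= big1 ?addr0 => [|i /andP[ai ii0]].
        by rewrite /e ki0 expr1n.
      rewrite /e (_ : (_ == _) = false) ?expr0n //; apply/eqP => ki.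
      case/eqP: ii0; apply: zinj; rewrite ?(eqP ai) ?(eqP ai0) //.
      by move: ki (eqP ki0); rewrite /kap ai ai0 => -> ->.
    rewrite big1 ?ler01 // => i ai; move: (none i); rewrite ai /= /e => ->.
    by rewrite expr0n.
  have -> : N k = \sum_(i | a i == 0) e k i ^+ 2 + \sum_(i | a i != 0) e k i ^+ 2.
    by rewrite /N (bigID (fun i => a i == 0)).
  lra.
pose E := \matrix_(k < w, i < p) (e k i / Num.sqrt (N k)).
pose FG := \matrix_(k < w, i < p + d.+1) (f k i / Num.sqrt (M k)).
pose F := lsubmx FG; pose G := rsubmx FG.
have Ee k i : E k i = e k i / Num.sqrt (N k) by rewrite mxE.
have Fe k i : F k i = f1 k i / Num.sqrt (M k) by rewrite !mxE fl.
have Ge k i : G k i = f2 k i / Num.sqrt (M k) by rewrite !mxE fr.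
have sN k : Num.sqrt (N k) != 0 by rewrite gt_eqF // sqrtr_gt0.
have sM k : Num.sqrt (M k) != 0 by rewrite gt_eqF // sqrtr_gt0.
have sN2 k : Num.sqrt (N k) ^+ 2 = N k by rewrite sqr_sqrtr // ltW.
have sM2 k : Num.sqrt (M k) ^+ 2 = M k by rewrite sqr_sqrtr // ltW.
exists E, F, G; split.
- apply: normalized_rows => // k l kl.
  by rewrite big1 // => i _; exact: e0.
- transitivity (FG *m FG^T).
    by rewrite -[FG in RHS]hsubmxK tr_row_mx mul_row_col.
  apply: normalized_rows => // k l kl.
  rewrite big_split_ord /= !big1 ?addr0 // => i _; rewrite ?fl ?fr.
    by rewrite f20.
  by rewrite f10.
move=> B C T hBC hT h1 h2 h3.
have Tsym k l : T k l = T l k by rewrite -[in LHS]hT mxE.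
(* Both Gram matrices on the zero level are diagonal. The entry [(k, l)] of the identity thus
   multiplies [T k l] by the share of [e_l] on one side and by that of [f_k] on the other; the first
   is at most 1/2, the second larger. *)
have T0u (k l : 'I_w) : (k <= u)%N -> T k l = 0.
  move=> ku; have := block_sym_zero_level hBC hT h1 h2 h3.
  move=> /matrixP/(_ k l); rewrite !mxE (bigD1 l) //= big1 ?addr0 => [|m ml]; last first.
    rewrite level_mx_entry big1 ?mulr0 // => i _.
    by rewrite !Ee mulrACA e0 ?mul0r.
  rewrite (bigD1 k) //= big1 ?addr0 => [|m mk]; last first.
    rewrite mxE level_mx_entry big1 => [|i _]; last first.
      by rewrite !Fe mulrACA f10 ?mul0r // eq_sym.
    rewrite mxE big1 ?addr0 ?mul0r // => i _.
    by rewrite !mxE -/(G k i) !fr mulrACA f20 ?mul0r // eq_sym.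
  have -> : (E *m level_mx a 0 *m E^T) l l = (\sum_(i | a i == 0) e l i ^+ 2) / N l.
    rewrite level_mx_entry mulr_suml; apply: eq_bigr => i _.
    by rewrite !Ee mulrACA -expr2 -invfM -expr2 sN2.
  have -> : (F *m level_mx a 0 *m F^T + G *m G^T) k k = num k / M k.
    rewrite mxE level_mx_entry mxE mulrDl !mulr_suml; congr (_ + _); apply: eq_bigr => i _.
      by rewrite !Fe mulrACA -expr2 -invfM -expr2 sM2.
    by rewrite [_^T _ _]mxE !Ge mulrACA -expr2 -invfM -expr2 sM2.
  have hP : (\sum_(i | a i == 0) e l i ^+ 2) / N l <= 1 / 2.
    by rewrite ler_pdivrMr //; have := N_ge l; lra.
  have hQ : 1 / 2 < num k / M k.
    by rewrite ltr_pdivlMr //; have := M_lt _ ku; lra.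
  rewrite [RHS]mulrC => /eqP; rewrite -subr_eq0 -mulrBr mulf_eq0 => /orP[/eqP //|].
  by rewrite subr_eq0 lt_eqF // (le_lt_trans hP).
(* For [k > u], row [k] follows from row [k - 1] through the nonzero level containing the position
   shared by [e_(k-1)] and [f_k]. *)
have T0 (n : nat) (k : 'I_w) : k = n :> nat -> forall l, T k l = 0.
  elim: n k => [|n IH] k kn l; first by rewrite T0u // kn.
  case: (leqP k u) => [ku|ku]; first exact: T0u.
    have nw : (n < w)%N by have := ltn_ord k; lia.
    pose k' := Ordinal nw.
    have [i0 ai0 pi0] := nsurj _ nw.
    have := block_sym_level hBC ai0 hT h2.
    set Rc := E *m _ *m _ => /matrixP/(_ l k').
    rewrite !mxE [in RHS]big1 => [|m _]; last by rewrite (Tsym m) IH ?mulr0.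
    have Re m : Rc k' m = \sum_(i | a i == a i0) E k' i * F m i.
      exact: level_mx_entry.
    (* On this level [e_k'] meets some [f_m] only at [i0], and only for [m = k]: its coordinates
       have residue below [w], where an [f] occurs only at a shared position. *)
    have key i m : a i == a i0 -> (i != i0) || (m != k) -> e k' i * f1 m i = 0.
      move=> /eqP ai; rewrite /e /f1 /kap /phi ai (negbTE ai0).
      have [ri|_] := eqVneq (r i) (k' : nat); last by rewrite mul0r.
      rewrite /= in ri; rewrite ri leqNgt nw /=; case: ifP => [/andP[up pw]|_]; last first.
        by move=> _; have mw := ltn_ord m; rewrite (_ : (_ == _) = false) ?mul0r ?mulr0 //; lia.
      have pin : pos i = n by rewrite -ri r_small.
      have -> : i = i0 by apply: ninj; rewrite ?ai // pin pi0.
      rewrite eqxx /= => mk.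
      by rewrite pi0 -kn (inj_eq val_inj) eq_sym (negbTE mk) mul0r mulr0.
    rewrite (bigD1 k) //= big1 ?addr0 => [|m mk].
      rewrite mxE Re (bigD1 i0) //= big1 ?addr0 => [|i /andP[ai ii0]].
        move/eqP; rewrite mulf_eq0 => /orP[/eqP <-|]; first exact: Tsym.
        rewrite Ee Fe mulf_eq0 !mulf_eq0 !invr_eq0 (negbTE (sN _)) (negbTE (sM _)) !orbF.
        rewrite /e /f1 /kap /phi (negbTE ai0) r_small pi0 // eqxx oner_eq0 /=.
        rewrite leqNgt nw /= (_ : (u <= n)%N); last by lia.
        by rewrite kn eqxx oner_eq0 gt_eqF.
      by rewrite Ee Fe mulrACA key ?ii0 // mul0r.
    rewrite mxE Re big1 ?mulr0 // => i ai.
    by rewrite Ee Fe mulrACA key ?mk ?orbT // mul0r.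
have TZ : T = 0 by apply/matrixP => k l; rewrite mxE (T0 k).
(* Once [T = 0], each equation is a vanishing sum that the supports reduce to a single term. *)
case: hBC => hB hS hC; move: h1 h2 h3; rewrite TZ !mul0mx mulmx0 => h1 h2 h3.
have zero_e i (k : 'I_w) i' : a i = 0 -> pos i = k -> i' != i -> a i' = 0 -> e k i' = 0.
  move=> ai pik ii' ai'; rewrite /e /kap ai' eqxx (_ : (_ == _) = false) //.
  by apply/eqP => pi'; case/eqP: ii'; apply: zinj; rewrite // pi'.
have uw i : a i = 0 -> (pos i < w)%N by move=> /zlt; lia.
have sum0 (k : 'I_w) i (g : 'I_p -> R) : E k i != 0 ->
    (forall j, j != i -> E k j * g j = 0) -> \sum_j E k j * g j = 0 -> g i = 0.
  move=> Eki h /eqP; rewrite (bigD1 i) //= big1 // addr0 mulf_eq0 (negbTE Eki) /=.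
  by move/eqP.
have E_neq0 (k : 'I_w) i : kap i = k -> E k i != 0.
  by move=> ki; rewrite Ee /e ki eqxx mul1r invr_eq0.
have CZ : C = 0.
  apply/matrixP => i c; rewrite mxE.
  have [ai|] := eqVneq (a i) 0; last exact: hC.
  have pw := uw _ ai; pose k := Ordinal pw.
  apply: (sum0 k i (C^~ c)) => [|j ji|]; last by move/matrixP/(_ k c): h3; rewrite !mxE.
    by apply: E_neq0; rewrite /kap ai eqxx.
  have [aj|aj] := eqVneq (a j) 0; last by rewrite hC // mulr0.
  by rewrite Ee (zero_e i) // !mul0r.
split=> //.
(* No other coordinate of the level of [i] has residue [r i], so on that level [e_(r i)] isolates
   row [i] of [B]. *)
have BsmallZ i j : a i != 0 -> (r i < w)%N -> B i j = 0.
  move=> ai rw; have [aij|] := eqVneq (a i) (a j); last exact: hB.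
  pose k := Ordinal rw.
  apply: (sum0 k i (B^~ j)) => [|i' ii'|]; last by move/matrixP/(_ k j): h2; rewrite !mxE.
    by apply: E_neq0; rewrite /kap (negbTE ai).
  have [ai'|ai'] := eqVneq (a i') (a j); last by rewrite hB // mulr0.
  rewrite Ee /e /kap ai' -aij (negbTE ai) (_ : (_ == _) = false) ?mul0r //.
  apply/eqP => ri; case/eqP: ii'; apply: nmod => //; first by rewrite ai' -aij.
  by rewrite aij.
apply/matrixP => i j; rewrite mxE.
have [aij|] := eqVneq (a i) (a j); last exact: hB.
have [ai|ai] := eqVneq (a i) 0.
  have pw := uw _ ai; pose k := Ordinal pw.
  apply: (sum0 k i (B^~ j)) => [|i' ii'|]; last by move/matrixP/(_ k j): h2; rewrite !mxE.
    by apply: E_neq0; rewrite /kap ai eqxx.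
  have [ai'|ai'] := eqVneq (a i') (a j); last by rewrite hB // mulr0.
  by rewrite Ee (zero_e i) // ?mul0r // ai' -aij.
have [rw|rw] := ltnP (r i) w; first exact: BsmallZ.
have aj : a j != 0 by rewrite -aij.
(* Here [i] belongs to [f_(r i - w)], and [B *m F^T = 0] gives information on the entry [B j i],
   with [i] as column index. *)
rewrite hS //.
have lw : (r i - w < w)%N.
  have : (r i < 2 * w)%N by rewrite ltn_mod; lia.
  lia.
pose l := Ordinal lw.
have Fli : F l i != 0.
  rewrite Fe /f1 /phi (negbTE ai) rw eqxx mul1r mulf_neq0 ?invr_eq0 //.
  by rewrite gt_eqF.
move/matrixP/(_ j l): h1; rewrite CZ mul0mx addr0 !mxE (bigD1 i) //= big1 ?addr0.
  by move/eqP; rewrite [F^T _ _]mxE mulf_eq0 (negbTE Fli) orbF => /eqP.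
move=> i' ii'; rewrite [F^T _ _]mxE.
have [ai'|ai'] := eqVneq (a i') (a j); last by rewrite hB 1?eq_sym // mul0r.
have [rw'|rw'] := ltnP (r i') w; first by rewrite hS // BsmallZ ?mul0r // ai'.
rewrite Fe /f1 /phi ai' (negbTE aj) rw' (_ : (_ == _) = false) ?mul0r ?mulr0 //.
apply/eqP => /= ri; case/eqP: ii'; apply: nmod; rewrite ?ai' //.
by rewrite -/(r i) -/(r i'); lia.
Qed.

(** * Frames adapted to an element of the Cartan subspace *)

(* Entrywise form of: [pmx B] commutes with [amx (p + d) X]. *)
Definition centralizes (R : realType) (p d : nat) (X : 'rV[R]_p)
    (B : 'M[R]_(p, p + d)) : Prop :=
  [/\ forall i j, `|X 0 i| != `|X 0 j| -> B i (lshift d j) = 0,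
      forall i j, Num.sg (X 0 i) * B i (lshift d j) =
                  Num.sg (X 0 j) * B j (lshift d i)
    & forall i c, X 0 i != 0 -> B i (rshift p c) = 0].

Definition zero_entries (R : realType) (p : nat) (X : 'rV[R]_p) : {set 'I_p} :=
  finset (fun i => X 0 i == 0).

Definition abs_class (R : realType) (p : nat) (X : 'rV[R]_p) (i : 'I_p) :
    {set 'I_p} :=
  finset (fun j => `|X 0 j| == `|X 0 i|).

(** Multiplying the rows of [B] by the signs of [X] reduces to [block_sym] for [|X|]; the frame [E]
    absorbs the signs. *)
Lemma frames_exist (R : realType) (p d w : nat) (X : 'rV[R]_p) :
  (0 < w)%N -> (#|zero_entries X| <= w)%N ->
  (w + #|zero_entries X| <= p)%N ->
  (forall i, X 0 i != 0 -> (#|abs_class X i| <= 2 * w)%N) ->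
  exists (E : 'M[R]_(w, p)) (F : 'M[R]_(w, p + d.+1)),
    [/\ E *m E^T = 1%:M, F *m F^T = 1%:M &
     forall B T, centralizes X B -> T^T = T ->
       B *m F^T = E^T *m T -> E *m B = T *m F -> B = 0].
Proof.
set Z := zero_entries X => w0 Zw wZp hcl.
pose a i := `|X 0 i|.
have a0 i : (a i == 0) = (i \in Z) by rewrite inE normr_eq0.
have [posZ [zinj zlt zsurj _]] : exists pos : 'I_p -> nat,
    [/\ {in Z &, injective pos},
        forall i, i \in Z -> (pos i < #|Z|)%N,
        forall k, (k < #|Z|)%N -> exists2 i, i \in Z & pos i = k
      & {in Z &, forall i j, a i = a j -> pos i = pos j %[mod p] -> i = j}].
  apply: sorted_positions => i iZ.
  by rewrite -[X in (_ <= X)%N]card_ord max_card.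
have [posN [ninj nlt nsurj nmod]] : exists pos : 'I_p -> nat,
    [/\ {in ~: Z &, injective pos},
        forall i, i \in ~: Z -> (pos i < #|~: Z|)%N,
        forall k, (k < #|~: Z|)%N -> exists2 i, i \in ~: Z & pos i = k
      & {in ~: Z &, forall i j, a i = a j -> pos i = pos j %[mod 2 * w] -> i = j}].
  apply: sorted_positions => i; rewrite !inE => iZ.
  apply: leq_trans (hcl i iZ); apply: subset_leq_card.
  by apply/fintype.subsetP => j; rewrite !inE => /andP[].
have cardN : (#|Z| + #|~: Z| = p)%N by rewrite cardsC card_ord.
pose pos i := if i \in Z then posZ i else posN i.
have N i : (a i != 0) = (i \in ~: Z) by rewrite a0 finset.in_setC.
have posZE i : i \in Z -> pos i = posZ i by rewrite /pos => ->.
have posNE i : i \in ~: Z -> pos i = posN i by rewrite /pos finset.in_setC => /negbTE ->.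
have [||||||E [F [G [hE hFG key]]]] :=
  @frames_of_positions R p d w #|Z| a pos w0 Zw.
- by move=> i /eqP; rewrite a0 => iZ; rewrite posZE // zlt.
- move=> i j /eqP + /eqP; rewrite !a0 => iZ jZ; rewrite !posZE //.
  exact: zinj.
- move=> k /zsurj[i iZ pk]; exists i; last by rewrite posZE.
  by apply/eqP; rewrite a0.
- by move=> i j; rewrite !N => iN jN; rewrite !posNE //; exact: ninj.
- move=> k kw; have [|i iN pk] := nsurj k; first by lia.
  by exists i; rewrite ?N // posNE.
- move=> i j; rewrite N => iN aij.
  have jN : j \in ~: Z by rewrite -N -aij N.
  by rewrite !posNE //; exact: nmod.
(* The value 1 at the zeros of [X] makes [S] an involution. *)
pose s : 'rV[R]_p := \row_i if X 0 i == 0 then 1 else Num.sg (X 0 i).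
pose S := diag_mx s.
have SS : S *m S = 1%:M.
  rewrite /S mul_diag_mx; apply/matrixP => i j; rewrite !mxE.
  have [_|_] := eqVneq i j; last by rewrite !mulr0n mulr0.
  case: ifP => Xi; rewrite ?mulr1 // -expr2 sqr_sg Xi //.
have ST : S^T = S by rewrite tr_diag_mx.
exists (E *m S), (row_mx F G); split.
- by rewrite trmx_mul ST mulmxA -(mulmxA E) SS mulmx1.
- by rewrite tr_row_mx mul_row_col.
move=> B T [hB hS hC] hT h1 h2.
have h2' : row_mx (E *m lsubmx (S *m B)) (E *m rsubmx (S *m B)) =
           row_mx (T *m F) (T *m G).
  by rewrite -!mul_mx_row hsubmxK mulmxA.
have [] := key (lsubmx (S *m B)) (rsubmx (S *m B)) T _ hT.
- split=> [i j aij|i j ai|i c ai]; rewrite /S mul_diag_mx !mxE.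
  + by rewrite hB // mulr0.
  + have Xi : X 0 i != 0 by rewrite -normr_eq0.
    rewrite (negbTE Xi) hS; case: ifP => // /eqP Xj.
    by rewrite (hB j i) ?mulr0 // Xj normr0 eq_sym.
  + by rewrite hC ?mulr0 // -normr_eq0.
- rewrite -mul_row_col -tr_row_mx hsubmxK -mulmxA h1.
  by rewrite trmx_mul ST !mulmxA SS mul1mx.
- by case/eq_row_mx: h2'.
- by case/eq_row_mx: h2'.
move=> l0 r0; have SB : S *m B = 0 by rewrite -[S *m B]hsubmxK l0 r0 row_mx0.
by rewrite -[B]mul1mx -SS -mulmxA SB mulmx0.
Qed.

(** * Completion of orthonormal families to orthogonal matrices *)

(** Induction on the number of missing columns. The prescribed columns may sit at any index set,
    since the frames will be placed at the nonzero entries of [Y]. *)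
Lemma orthonormal_completion (R : realType) (n : nat) (S : {set 'I_n})
    (e : 'I_n -> 'cV[R]_n) :
  {in S &, forall k l, (e k)^T *m e l = ((k == l)%:R)%:M} ->
  exists2 A : 'M[R]_n, A^T *m A = 1%:M & {in S, forall k, col k A = e k}.
Proof.
have [m] := ubnP #|~: S|; elim: m S e => // m IH S e Sm hS.
have [k0 k0S|full] := pickP (fun k => k \in ~: S); last first.
  have inS k : k \in S by have := full k; rewrite finset.in_setC => /negbFE.
  pose A := \matrix_(i, k) e k i 0.
  have cA k : col k A = e k by apply/colP => i; rewrite !mxE.
  exists A => // ; apply/matrixP => k l.
  have := hS k l (inS k) (inS l) => /matrixP/(_ 0 0); rewrite !mxE eqxx mulr1n => <-.
  by apply: eq_bigr => i _; rewrite !mxE.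
(* The column [k0] of [Q] is zero, so [Q] is singular, and a left kernel vector is orthogonal to all
   prescribed columns. *)
pose Q := \matrix_(i, k) (if k \in S then e k i 0 else 0).
have /det0P[x x0 xQ] : \det Q == 0.
  rewrite (expand_det_col _ k0) big1 // => i _.
  by rewrite mxE (negbTE (_ : k0 \notin S)) ?mul0r -?finset.in_setC.
pose N := \sum_i x 0 i ^+ 2.
have N_gt0 : 0 < N.
  rewrite lt_def sumr_ge0 ?andbT => [|i _]; last exact: sqr_ge0.
  apply: contra x0 => /eqP/psumr_eq0P h; apply/eqP/rowP => i; rewrite mxE.
  by apply/eqP; rewrite -sqrf_eq0 h // => j _; exact: sqr_ge0.
pose y : 'cV[R]_n := (Num.sqrt N)^-1 *: x^T.
have yy : y^T *m y = 1%:M.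
  apply/matrixP => i j; rewrite !ord1 !mxE eqxx mulr1n -[RHS](divff (lt0r_neq0 N_gt0)).
  rewrite /N mulr_suml; apply: eq_bigr => k _; rewrite !mxE.
  by rewrite mulrACA -expr2 -expr2 exprVn sqr_sqrtr ?ltW // mulrC.
have xe k : k \in S -> x *m e k = 0.
  move=> kS; apply/matrixP => i j; rewrite !ord1 !mxE.
  have := congr1 (fun u : 'rV_n => u 0 k) xQ; rewrite !mxE => h; rewrite -[RHS]h.
  by apply: eq_bigr => l _; rewrite mxE kS.
have ye k : k \in S -> y^T *m e k = 0.
  by move=> kS; rewrite /y linearZ /= trmxK -scalemxAl xe ?scaler0.
have ey k : k \in S -> (e k)^T *m y = 0.
  by move=> kS; apply: trmx_inj; rewrite trmx_mul trmxK ye // trmx0.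
pose e' k := if k == k0 then y else e k.
have [||A AA hA] := IH (k0 |: S) e'.
- rewrite -ltnS; apply: leq_ltn_trans Sm; apply: proper_card.
  rewrite finset.setCU; apply/properP; split; first exact: finset.subsetIr.
  by exists k0 => //; rewrite !inE eqxx.
- move=> k l; rewrite !finset.in_setU1 /e'.
  have [->|kk0] := eqVneq k k0; have [->|lk0] := eqVneq l k0 => //= kS lS.
  + by rewrite ye // raddf0.
  + by rewrite ey // (negbTE kk0) raddf0.
  + exact: hS.
exists A => // k kS; rewrite hA ?finset.in_setU1 ?kS ?orbT // /e'.
by case: eqP k0S => // <-; rewrite finset.in_setC kS.
Qed.

Lemma orthonormal_rows_completion (R : realType) (w n : nat) (h : 'I_w -> 'I_n)
    (E : 'M[R]_(w, n)) :
  injective h -> E *m E^T = 1%:M ->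
  exists2 A : 'M[R]_n, A^T *m A = 1%:M & forall k i, A i (h k) = E k i.
Proof.
move=> hinj EE.
pose e k : 'cV[R]_n :=
  if [pick j | h j == k] is Some j then (row j E)^T else 0.
have eh j : e (h j) = (row j E)^T.
  rewrite /e; case: pickP => [j' /eqP/hinj -> //|/(_ j)].
  by rewrite eqxx.
have [|A AA hA] := @orthonormal_completion R n (finset (fun k => k \in codom h)) e.
  move=> k l; rewrite !inE => /codomP[k' ->] /codomP[l' ->]; rewrite !eh.
  have /matrixP/(_ k' l') := EE; rewrite !mxE => Ekl.
  apply/matrixP => i j; rewrite !ord1 !mxE eqxx mulr1n (inj_eq hinj) -Ekl.
  by apply: eq_bigr => c _; rewrite !mxE.
exists A => // k i.
have /hA/colP/(_ i) : h k \in finset (fun k => k \in codom h).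
  by rewrite inE codom_f.
by rewrite eh !mxE.
Qed.

(** * Orthogonal pairs making the two centralizers meet trivially *)

(** The frames become the columns of [A] and [D] at the nonzero entries of [Y], with the signs of
    [Y] put into [D]. The block of [A^T *m B *m D] at these entries supplies the symmetric matrix
    [T]. *)
Lemma transversal_of_zeros_le (R : realType) (p d : nat) (X Y : 'rV[R]_p) :
  let w := (p - #|zero_entries Y|)%N in
  (0 < w)%N -> (#|zero_entries X| <= #|zero_entries Y|)%N ->
  (#|zero_entries X| <= w)%N ->
  (forall i, X 0 i != 0 -> (#|abs_class X i| <= 2 * w)%N) ->
  exists (A : 'M[R]_p) (D : 'M[R]_(p + d.+1)),
    [/\ A^T *m A = 1%:M, D^T *m D = 1%:M &
     forall B, centralizes X B -> centralizes Y (A^T *m B *m D) -> B = 0].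
Proof.
pose NZ := ~: zero_entries Y.
have cNZ : (#|zero_entries Y| + #|NZ| = p)%N by rewrite cardsC card_ord.
have -> : (p - #|zero_entries Y|)%N = #|NZ| by lia.
move=> w w0 XY Xw hcl.
have NZE i : (i \in NZ) = (Y 0 i != 0) by rewrite !inE.
have [||//|E [F [EE FF key]]] := @frames_exist R p d w X w0; rewrite /w //; first by lia.
pose h (k : 'I_w) : 'I_p := enum_val k.
have hinj : injective h by exact: enum_val_inj.
have Yh k : Y 0 (h k) != 0 by rewrite -NZE enum_valP.
pose s : 'rV[R]_w := \row_k Num.sg (Y 0 (h k)).
have ss k : s 0 k * s 0 k = 1 by rewrite mxE -expr2 sqr_sg Yh.
have [A AA hA] := orthonormal_rows_completion hinj EE.
have [D DD hD] : exists2 D : 'M[R]_(p + d.+1), D^T *m D = 1%:M &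
    forall k i, D i (lshift d.+1 (h k)) = (diag_mx s *m F) k i.
  apply: orthonormal_rows_completion.
    by move=> k l /lshift_inj/hinj.
  rewrite trmx_mul tr_diag_mx mulmxA -(mulmxA _ F) FF mulmx1.
  rewrite mul_diag_mx; apply/matrixP => k l; rewrite [LHS]mxE [diag_mx s k l]mxE [RHS]mxE.
  by case: eqVneq => [->|_]; rewrite ?mulr1n ?ss // mulr0n mulr0.
have AA' : A *m A^T = 1%:M by exact: mulmx1C.
have DD' : D *m D^T = 1%:M by exact: mulmx1C.
exists A, D; split=> // B hX.
move eM: (A^T *m B *m D) => M [hM hS hC].
(* The factor [s 0 l], also present in the column of [D] at [h l], turns the signed symmetry of [M]
   into [T^T = T]. *)
pose T := \matrix_(k < w, l < w) (s 0 l * M (h k) (lshift d.+1 (h l))).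
have M0 i k : i \notin NZ -> M i (lshift d.+1 (h k)) = 0 /\ M (h k) (lshift d.+1 i) = 0.
  rewrite NZE negbK => /eqP Yi.
  by split; rewrite hM // Yi normr0 ?(eq_sym 0) normr_eq0.
apply: (key B T) => //.
- apply/matrixP => k l; rewrite !mxE.
  have := hS (h k) (h l); move: (ss k) (ss l); rewrite !mxE => sk sl e.
  set x := M (h k) _ in e *; set y := M (h l) _ in e *.
  have -> : x = Num.sg (Y 0 (h k)) * (Num.sg (Y 0 (h k)) * x) by rewrite mulrA sk mul1r.
  by rewrite e [RHS]mulrCA (mulrA (Num.sg (Y 0 (h l)))) sl mul1r.
- have BD : B *m D = A *m M by rewrite -eM !mulmxA AA' mul1mx.
  apply/matrixP => i l.
  transitivity (s 0 l * (B *m D) i (lshift d.+1 (h l))).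
    rewrite !mxE mulr_sumr; apply: eq_bigr => c _.
    rewrite hD mul_diag_mx !mxE mulrCA (mulrA (Num.sg _)).
    by have := ss l; rewrite !mxE => ->; rewrite mul1r.
  rewrite BD !mxE (bigID (fun j => j \in NZ)) /= [X in _ + X]big1 ?addr0.
    rewrite big_enum_val mulr_sumr; apply: eq_bigr => k _.
    by rewrite !mxE hA; ring.
  by move=> j jN; rewrite (M0 j l jN).1 mulr0.
- have AB : A^T *m B = M *m D^T by rewrite -eM -mulmxA DD' mulmx1.
  apply/matrixP => k c.
  transitivity ((A^T *m B) (h k) c).
    by rewrite !mxE; apply: eq_bigr => i _; rewrite !mxE hA.
  rewrite AB !mxE big_split_ord /= [X in _ + X]big1 ?addr0 => [|j _]; last first.
    by rewrite hC // mul0r.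
  rewrite (bigID (fun j => j \in NZ)) /= [X in _ + X]big1 ?addr0; last first.
    by move=> j jN; rewrite (M0 j k jN).2 mul0r.
  rewrite big_enum_val; apply: eq_bigr => l _.
  by rewrite mxE hD mul_diag_mx !mxE -/(h l); ring.
Qed.

(** Passing to the transposes of [A] and [D] exchanges [X] and [Y], so [X] may be assumed to have at
    most as many zeros as [Y]. *)
Lemma transversal_exists (R : realType) (p d : nat) (X Y : 'rV[R]_p) :
  (0 < p)%N ->
  (#|zero_entries X| + #|zero_entries Y| <= p)%N ->
  (forall i, X 0 i != 0 -> (#|abs_class X i| <= 2 * (p - #|zero_entries Y|))%N) ->
  (forall i, Y 0 i != 0 -> (#|abs_class Y i| <= 2 * (p - #|zero_entries X|))%N) ->
  exists (A : 'M[R]_p) (D : 'M[R]_(p + d.+1)),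
    [/\ A^T *m A = 1%:M, D^T *m D = 1%:M &
     forall B, centralizes X B -> centralizes Y (A^T *m B *m D) -> B = 0].
Proof.
wlog XY : X Y / (#|zero_entries X| <= #|zero_entries Y|)%N.
  move=> H p0 le hX hY; case: (leqP #|zero_entries X| #|zero_entries Y|) => XY.
    exact: H.
  have [||||A [D [AA DD key]]] := H Y X _ p0; rewrite 1?addnC // 1?ltnW //.
  have AA' : A *m A^T = 1%:M by exact: mulmx1C.
  have DD' : D *m D^T = 1%:M by exact: mulmx1C.
  exists A^T, D^T; split; rewrite ?trmxK // => B hB hB'.
  have B0 : A *m B *m D^T = 0.
    apply: key => //.
    by rewrite !mulmxA AA mul1mx -mulmxA DD mulmx1.
  have <- : A^T *m (A *m B *m D^T) *m D = B.
    by rewrite !mulmxA AA mul1mx -mulmxA DD mulmx1.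
  by rewrite B0 mulmx0 mul0mx.
move=> p0 le hX _.
apply: transversal_of_zeros_le => //; last by lia.
(* The frame size is positive: either the first entry of [X] is a zero, and the zeros of [X] number
   at most the frame size, or its class is nonempty and has at most twice that size. *)
have [X0|X0] := eqVneq (X 0 (Ordinal p0)) 0.
  have : (0 < #|zero_entries X|)%N.
    by apply/card_gt0P; exists (Ordinal p0); rewrite inE X0.
  lia.
have : (0 < #|abs_class X (Ordinal p0)|)%N.
  by apply/card_gt0P; exists (Ordinal p0); rewrite inE.
have := hX _ X0; lia.
Qed.

(** * Correction of the determinants *)

(** The entries [(i, j)] and [(j, i)] of the square block are multiplied by the same factor
    [s_i * s_j]. *)
Lemma centralizes_sign (R : realType) (p d : nat) (Y : 'rV[R]_p)
    (M : 'M[R]_(p, p + d)) (s : 'rV[R]_p) (t : 'rV[R]_d) :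
  centralizes Y M ->
  centralizes Y (diag_mx s *m M *m diag_mx (row_mx s t)).
Proof.
move=> [h1 h2 h3].
have entry i c : (diag_mx s *m M *m diag_mx (row_mx s t)) i c =
    s 0 i * M i c * row_mx s t 0 c.
  by rewrite mul_diag_mx mul_mx_diag !mxE.
split=> [i j ij|i j|i c ci]; rewrite !entry.
- by rewrite h1 // mulr0 mul0r.
- rewrite !row_mxEl; have := h2 i j; set x := M i _; set y := M j _ => e.
  transitivity (s 0 i * s 0 j * (Num.sg (Y 0 i) * x)); first by rewrite /x; ring.
  by rewrite e /y; ring.
- by rewrite h3 // mulr0 mul0r.
Qed.

Lemma det_orthogonal_sqr (R : realType) (n : nat) (A : 'M[R]_n) :
  A^T *m A = 1%:M -> \det A * \det A = 1.
Proof. by move=> /(congr1 determinant); rewrite det_mulmx det_tr det1. Qed.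

Lemma diag_sign_sqr (R : realType) (n : nat) (s : 'rV[R]_n) :
  (forall i, s 0 i * s 0 i = 1) -> diag_mx s *m diag_mx s = 1%:M.
Proof.
move=> ss; rewrite mul_diag_mx; apply/matrixP => k l.
rewrite [LHS]mxE [diag_mx s k l]mxE [RHS]mxE.
by case: eqVneq => [->|_]; rewrite ?mulr1n ?ss // mulr0n mulr0.
Qed.

Lemma transversal_SO (R : realType) (p d : nat) (X Y : 'rV[R]_p)
    (A : 'M[R]_p) (D : 'M[R]_(p + d.+1)) :
  (0 < p)%N -> A^T *m A = 1%:M -> D^T *m D = 1%:M ->
  (forall B, centralizes X B -> centralizes Y (A^T *m B *m D) -> B = 0) ->
  exists (A' : 'M[R]_p) (D' : 'M[R]_(p + d.+1)),
    [/\ SO A', SO D' &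
     forall B, centralizes X B -> centralizes Y (A'^T *m B *m D') -> B = 0].
Proof.
move=> p0 AA DD key.
have dA := det_orthogonal_sqr AA; have dD := det_orthogonal_sqr DD.
pose s : 'rV[R]_p := \row_i if i == Ordinal p0 then \det A else 1.
(* The entry at 0 cancels the factor [\det A] brought in by [s] and inserts [\det D]; a coordinate
   beyond [p] makes room for it. *)
pose t : 'rV[R]_d.+1 := \row_c if c == 0 then \det A * \det D else 1.
have hs i : s 0 i * s 0 i = 1 by rewrite mxE; case: ifP; rewrite ?mulr1.
have ht c : t 0 c * t 0 c = 1.
  by rewrite mxE; case: ifP; rewrite ?mulr1 // mulrACA dA dD mulr1.
have hst c : row_mx s t 0 c * row_mx s t 0 c = 1.
  by rewrite -(splitK c); case: (split c) => j; rewrite /= ?row_mxEl ?row_mxEr.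
have ds : \det (diag_mx s) = \det A.
  rewrite det_diag (bigD1 (Ordinal p0)) //= big1 ?mulr1 ?mxE ?eqxx // => i i0.
  by rewrite mxE (negbTE i0).
have dt : \det (diag_mx (row_mx s t)) = \det D.
  rewrite det_diag big_split_ord /=.
  under eq_bigr do rewrite row_mxEl.
  rewrite -det_diag ds.
  under eq_bigr do rewrite row_mxEr.
  rewrite (bigD1 0) //= big1 ?mulr1 => [|c c0]; last by rewrite mxE (negbTE c0).
  by rewrite mxE eqxx mulrA dA mul1r.
have SS := diag_sign_sqr hs; have TT := diag_sign_sqr hst.
exists (A *m diag_mx s), (D *m diag_mx (row_mx s t)); split.
- split; last by rewrite det_mulmx ds.
  by rewrite trmx_mul tr_diag_mx mulmxA -(mulmxA _ A^T) AA mulmx1.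
- split; last by rewrite det_mulmx dt.
  by rewrite trmx_mul tr_diag_mx mulmxA -(mulmxA _ D^T) DD mulmx1.
move=> B hX hY; apply: key => //.
have := centralizes_sign s t hY.
rewrite trmx_mul tr_diag_mx !mulmxA SS mul1mx -!mulmxA TT mulmx1.
by rewrite !mulmxA.
Qed.

(** * Level sizes read off the configuration *)

Lemma count_abs_entries (R : realType) (p : nat) (X : 'rV[R]_p) (x : R) :
  count_mem x (abs_entries X) = #|finset (fun i => `|X 0 i| == x)|.
Proof.
rewrite /abs_entries count_sort count_map.
rewrite -sum1_count -sum1_card big_enum_cond /=.
by apply: eq_bigl => i; rewrite inE.
Qed.

Lemma configuration_zeros (R : realType) (p : nat) (X : 'rV[R]_p) s u :
  configuration X = (s, u) -> #|zero_entries X| = u.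
Proof.
case=> _ <-; rewrite count_abs_entries; apply: eq_card => i.
by rewrite !inE normr_eq0.
Qed.

Lemma configuration_class (R : realType) (p : nat) (X : 'rV[R]_p) s u i :
  configuration X = (s, u) -> X 0 i != 0 ->
  (#|abs_class X i| <= \max_(j <- s) j)%N.
Proof.
case=> <- _ Xi; rewrite /abs_class -count_abs_entries.
set x := undup _; set c := count_mem _ _.
have xi : `|X 0 i| \in x.
  rewrite mem_undup mem_filter normr_gt0 Xi /= mem_sort.
  by apply: map_f; rewrite mem_enum.
case: ifP => [|_]; first by case: x xi.
by apply: leq_bigmax_seq => //; apply: map_f.
Qed.

(** * Explicit root vectors *)

Definition a_block (R : realType) (p q : nat) (H : 'rV[R]_p) : 'M[R]_(p, q) :=
  \matrix_(i < p, j < q) (if i == j :> nat then H 0 i else 0).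

Lemma mul_a_block_lshift (R : realType) (p d n : nat) (H : 'rV[R]_p) (j : 'I_p)
    (k : 'I_n) :
  a_block (p + d) H *m delta_mx (lshift d j) k = H 0 j *: delta_mx j k.
Proof.
apply/matrixP => x y; rewrite !mxE (bigD1 (lshift d j)) //= big1 ?addr0.
  rewrite !mxE eqxx /= (inj_eq val_inj).
  by case: eqVneq => [->|_]; rewrite ?mul0r ?mulr0.
by move=> z zj; rewrite !mxE (negbTE zj) mulr0.
Qed.

Lemma mul_a_block_rshift (R : realType) (p d n : nat) (H : 'rV[R]_p) (c : 'I_d)
    (k : 'I_n) :
  a_block (p + d) H *m delta_mx (rshift p c) k = 0.
Proof.
apply/matrixP => x y; rewrite !mxE (bigD1 (rshift p c)) //= big1 ?addr0.
  by rewrite !mxE /= ltn_eqF ?mul0r // ltn_addr.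
by move=> z zj; rewrite !mxE (negbTE zj) mulr0.
Qed.

Lemma mul_delta_a_block (R : realType) (p d n : nat) (H : 'rV[R]_p) (j : 'I_p)
    (k : 'I_n) :
  delta_mx k j *m a_block (p + d) H = H 0 j *: delta_mx k (lshift d j).
Proof.
apply/matrixP => x y; rewrite !mxE (bigD1 j) //= big1 ?addr0.
  rewrite !mxE eqxx andbT -(inj_eq val_inj _ (lshift d j)) /= (eq_sym (y : nat)).
  by case: (x == k); case: (nat_of_ord j == y); rewrite ?mulr1 ?mul1r ?mulr0 ?mul0r.
by move=> z zj; rewrite !mxE (negbTE zj) andbF mul0r.
Qed.

Lemma mul_tr_a_block (R : realType) (p d n : nat) (H : 'rV[R]_p) (j : 'I_p)
    (k : 'I_n) :
  (a_block (p + d) H)^T *m delta_mx j k = H 0 j *: delta_mx (lshift d j) k.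
Proof.
by apply: trmx_inj; rewrite trmx_mul trmxK linearZ /= !trmx_delta mul_delta_a_block.
Qed.

Lemma mul_delta_tr_a_block_lshift (R : realType) (p d n : nat) (H : 'rV[R]_p)
    (j : 'I_p) (k : 'I_n) :
  delta_mx k (lshift d j) *m (a_block (p + d) H)^T = H 0 j *: delta_mx k j.
Proof.
by apply: trmx_inj; rewrite trmx_mul trmxK linearZ /= !trmx_delta mul_a_block_lshift.
Qed.

Lemma mul_delta_tr_a_block_rshift (R : realType) (p d n : nat) (H : 'rV[R]_p)
    (c : 'I_d) (k : 'I_n) :
  delta_mx k (rshift p c) *m (a_block (p + d) H)^T = 0.
Proof.
by apply: trmx_inj; rewrite trmx_mul trmxK !trmx_delta mul_a_block_rshift trmx0.
Qed.

Definition a_blockE := (mul_a_block_lshift, mul_a_block_rshift,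
  mul_delta_a_block, mul_tr_a_block, mul_delta_tr_a_block_lshift,
  mul_delta_tr_a_block_rshift).

Lemma scalar_exists (R : realType) (p : nat) (f : 'rV[R]_p -> R) :
  (forall (c : R) H H', f (c *: H + H') = c * f H + f H') ->
  exists alpha : {scalar 'rV[R]_p}, forall H, alpha H = f H.
Proof.
move=> lf.
pose alpha : {scalar 'rV[R]_p} :=
  HB.pack f (GRing.isLinear.Build R 'rV[R]_p R *%R f lf).
by exists alpha.
Qed.

Lemma lin_span0 (R : realType) (V : vectType R) (S : set V) : lin_span S 0.
Proof. by exists [::] => //; exact: mem0v. Qed.

Lemma lin_span_lincomb (R : realType) (V : vectType R) (S : set V) (c : R) v w :
  lin_span S v -> lin_span S w -> lin_span S (c *: v + w).
Proof.
move=> [s hs vs] [t ht wt]; exists (s ++ t).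
  by move=> x; rewrite mem_cat => /orP[/hs|/ht].
by rewrite span_cat memv_add // memvZ.
Qed.

Lemma lin_span_sum (R : realType) (V : vectType R) (S : set V) (I : finType)
    (c : I -> R) (g : I -> V) :
  (forall i, lin_span S (g i)) -> lin_span S (\sum_i c i *: g i).
Proof.
move=> hg; apply: (big_ind (fun v => lin_span S v)).
- exact: lin_span0.
- by move=> v w hv hw; rewrite -[v]scale1r; exact: lin_span_lincomb.
- by move=> i _; rewrite -[_ *: _]addr0; apply: lin_span_lincomb => //; exact: lin_span0.
Qed.

(** The equations are three blocks of the relation making [block_mx a b b^T e] a root vector for
    [f]; the fourth block is the transpose of the third. Its image under [W - theta W] is
    [2 *: pmx b]. *)
Lemma VZ_root (R : realType) (p q : nat) (X : 'rV[R]_p) (f : 'rV[R]_p -> R)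
    (a : 'M[R]_p) (b : 'M[R]_(p, q)) (e : 'M[R]_q) :
  (forall (c : R) H H', f (c *: H + H') = c * f H + f H') -> f X != 0 ->
  a^T = - a -> e^T = - e ->
  (forall H, a_block q H *m b^T - b *m (a_block q H)^T = f H *: a) ->
  (forall H, (a_block q H)^T *m b - b^T *m a_block q H = f H *: e) ->
  (forall H, a_block q H *m e - a *m a_block q H = f H *: b) ->
  VZ q X (pmx b).
Proof.
move=> lf fX aT eT h1 h2 h3.
have [alpha alphaE] := scalar_exists lf.
pose W := block_mx a b b^T e.
have UE : W - theta W = 2 *: pmx b.
  rewrite /theta opprK /W tr_block_mx trmxK aT eT add_block_mx !subrr.
  by rewrite /pmx scale_block_mx !scaler0 !scaler_nat !mulr2n.
(* The case [b = 0] occurs for the functional [2 H_i], which is not a root: it comes from equal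
   indices and sign -1. *)
have [b0|b0] := eqVneq (pmx b) 0; first by rewrite b0; exact: lin_span0.
have W0 : W != 0.
  apply: contra b0 => /eqP W0; move: UE; rewrite /theta W0 trmx0 !oppr0 addr0.
  by move/esym/eqP; rewrite scaler_eq0 pnatr_eq0.
have rootW : root_space q alpha W.
  split.
    rewrite /so /= /W tr_block_mx trmxK /Ipq !mulmx_block.
    rewrite !mulmx0 !mul0mx !mulmxN !mulNmx !mulmx1 !mul1mx !addr0 !add0r.
    by rewrite add_block_mx aT eT !opprK !subrr !addNr block_mx0.
  move=> H; rewrite alphaE /bracket /amx /pmx -/(a_block q H) /W !mulmx_block.
  rewrite !mul0mx !mulmx0 !addr0 !add0r opp_block_mx add_block_mx scale_block_mx.
  rewrite h1 h2 h3; congr block_mx.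
  apply: trmx_inj; rewrite linearB /= !trmx_mul !linearZ /= !trmxK aT eT.
  by rewrite mulNmx mulmxN opprK addrC h3.
exists [:: W - theta W].
  move=> U; rewrite inE => /eqP ->; exists alpha, W; split=> //.
    split; last by exists W.
    by exists X; rewrite alphaE.
  by rewrite alphaE.
have -> : pmx b = 2^-1 *: (W - theta W).
  by rewrite UE scalerA mulVf ?scale1r // pnatr_eq0.
by rewrite memvZ // memv_span // mem_head.
Qed.

(** The root is [H_i - H_j] for [s = 1] and [H_i + H_j] for [s = -1]. *)
Lemma VZ_pair (R : realType) (p d : nat) (X : 'rV[R]_p) (s : R) (i j : 'I_p) :
  s = 1 \/ s = -1 -> X 0 i - s * X 0 j != 0 ->
  VZ (p + d) X (pmx (delta_mx i (lshift d j) + s *: delta_mx j (lshift d i))).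
Proof.
move=> hs hX.
have bT : (delta_mx i (lshift d j) + s *: delta_mx j (lshift d i))^T =
    delta_mx (lshift d j) i + s *: delta_mx (lshift d i) j.
  by rewrite linearD /= linearZ /= !trmx_delta.
apply: (@VZ_root _ _ _ X (fun H => H 0 i - s * H 0 j)
  (s *: (delta_mx i j - delta_mx j i)) _
  (delta_mx (lshift d i) (lshift d j) - delta_mx (lshift d j) (lshift d i))) => //.
- by move=> c H H'; rewrite !mxE; ring.
- by rewrite linearZ /= linearB /= !trmx_delta -scalerN opprB.
- by rewrite linearB /= !trmx_delta opprB.
- move=> H; rewrite bT mulmxDr mulmxDl -scalemxAr -scalemxAl !a_blockE.
  by apply/matrixP => x y; rewrite !mxE; case: hs => ->; ring.
- move=> H; rewrite bT mulmxDr mulmxDl -scalemxAr -scalemxAl !a_blockE.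
  by apply/matrixP => x y; rewrite !mxE; case: hs => ->; ring.
- move=> H; rewrite mulmxBr -scalemxAl mulmxBl !a_blockE.
  by apply/matrixP => x y; rewrite !mxE; case: hs => ->; ring.
Qed.

(** The index [c] accounts for the multiplicity [q - p] of the root [H_i]. *)
Lemma VZ_single (R : realType) (p d : nat) (X : 'rV[R]_p) (i : 'I_p) (c : 'I_d) :
  X 0 i != 0 -> VZ (p + d) X (pmx (delta_mx i (rshift p c))).
Proof.
move=> hX.
apply: (@VZ_root _ _ _ X (fun H => H 0 i) 0 _
  (delta_mx (lshift d i) (rshift p c) - delta_mx (rshift p c) (lshift d i))) => //.
- by move=> c' H H'; rewrite !mxE.
- by rewrite trmx0 oppr0.
- by rewrite linearB /= !trmx_delta opprB.
- by move=> H; rewrite trmx_delta !a_blockE subrr scaler0.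
- by move=> H; rewrite trmx_delta !a_blockE -scalerBr.
- by move=> H; rewrite mul0mx subr0 mulmxBr !a_blockE subr0.
Qed.

(** * Duality for the trace form *)

Lemma mxtrace_mul_tr (R : realType) (m n : nat) (B G : 'M[R]_(m, n)) :
  \tr (B *m G^T) = \sum_i \sum_j B i j * G i j.
Proof.
by apply: eq_bigr => i _; rewrite mxE; apply: eq_bigr => j _; rewrite mxE.
Qed.

Lemma mxtrace_mul_tr_delta (R : realType) (m n : nat) (B : 'M[R]_(m, n)) i j :
  \tr (B *m (delta_mx i j)^T) = B i j.
Proof.
rewrite mxtrace_mul_tr (bigD1 i) //= (bigD1 j) //= !big1 ?addr0.
- by rewrite mxE !eqxx mulr1.
- by move=> k ki; rewrite big1 // => l _; rewrite mxE (negbTE ki) mulr0.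
- by move=> l lj; rewrite mxE (negbTE lj) andbF mulr0.
Qed.

(** With the members of the family as rows of [G], a vector killed by [G^T] is a matrix orthogonal
    to all of them; so [G] has full rank. *)
Lemma spanning_of_orthogonal (R : realType) (m n : nat) (J : finType)
    (g : J -> 'M[R]_(m, n)) :
  (forall B, (forall t, \tr (B *m (g t)^T) = 0) -> B = 0) ->
  forall B, exists c : J -> R, B = \sum_t c t *: g t.
Proof.
move=> hg B.
pose G : 'M[R]_(#|J|, m * n) := \matrix_k mxvec (g (enum_val k)).
have dot (C D : 'M[R]_(m, n)) : (mxvec C *m (mxvec D)^T) 0 0 = \tr (C *m D^T).
  rewrite mxtrace_mul_tr pair_bigA mxE /= (reindex _ (curry_mxvec_bij m n)) /=.
  by apply: eq_bigr => -[i j] _; rewrite mxE /= !mxvecE.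
have fullG : row_full G.
  rewrite /row_full -mxrank_tr -/(row_free G^T) -kermx_eq0.
  apply/eqP/row_matrixP => i; rewrite row0.
  have /sub_kermxP : (row i (kermx G^T) <= kermx G^T)%MS by exact: row_sub.
  move: (row i _) => v vG; rewrite -[v]vec_mxK [vec_mx v]hg ?linear0 // => t.
  rewrite -dot vec_mxK; have /rowP/(_ (enum_rank t)) := vG.
  rewrite !mxE => e; rewrite -[RHS]e; apply: eq_bigr => k _.
  by rewrite !mxE enum_rankK.
have /submxP[c hc] : (mxvec B <= G)%MS by exact: submx_full.
exists (fun t => c 0 (enum_rank t)).
apply: (can_inj mxvecK); rewrite hc mulmx_sum_row linear_sum /=.
rewrite (reindex (@enum_val J predT)) /=; last exact/onW_bij/enum_val_bij.
by apply: eq_bigr => k _; rewrite rowK linearZ /= enum_valK.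
Qed.

(** The scalar factor is the value of the root at [X]: a root vanishing at [X] contributes 0, and
    one index type serves for every [X]. *)
Definition VZ_generator (R : realType) (p d : nat) (X : 'rV[R]_p)
    (t : 'I_p * 'I_p * bool + 'I_p * 'I_d) : 'M[R]_(p, p + d) :=
  match t with
  | inl (i, j, b) => (X 0 i - (-1) ^+ b * X 0 j) *:
      (delta_mx i (lshift d j) + (-1) ^+ b *: delta_mx j (lshift d i))
  | inr (i, c) => X 0 i *: delta_mx i (rshift p c)
  end.

(** Orthogonality to the pair generators says that [X_i - X_j] kills [B_ij + B_ji] and that
    [X_i + X_j] kills [B_ij - B_ji]. *)
Lemma centralizes_of_orthogonal (R : realType) (p d : nat) (X : 'rV[R]_p)
    (B : 'M[R]_(p, p + d)) :
  (forall t, \tr (B *m (VZ_generator X t)^T) = 0) -> centralizes X B.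
Proof.
move=> h.
have h1 i j : (X 0 i - X 0 j) * (B i (lshift d j) + B j (lshift d i)) = 0.
  have := h (inl (i, j, false)); rewrite /= expr0 mul1r scale1r.
  rewrite linearZ /= linearD /= -scalemxAr mulmxDr linearZ /= linearD /=.
  by rewrite !mxtrace_mul_tr_delta.
have h2 i j : (X 0 i + X 0 j) * (B i (lshift d j) - B j (lshift d i)) = 0.
  have := h (inl (i, j, true)); rewrite /= expr1 mulN1r opprK scaleN1r.
  rewrite linearZ /= linearB /= -scalemxAr mulmxBr linearZ /= linearB /=.
  by rewrite !mxtrace_mul_tr_delta.
have h3 i c : X 0 i * B i (rshift p c) = 0.
  have := h (inr (i, c)); rewrite /= linearZ /= -scalemxAr linearZ /=.
  by rewrite mxtrace_mul_tr_delta.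
have abs_ne i j : `|X 0 i| != `|X 0 j| -> B i (lshift d j) = 0.
  move=> ij.
  have n1 : X 0 i - X 0 j != 0.
    by apply: contra ij; rewrite subr_eq0 => /eqP ->.
  have n2 : X 0 i + X 0 j != 0.
    by apply: contra ij; rewrite addr_eq0 => /eqP ->; rewrite normrN.
  have := h1 i j; have := h2 i j.
  move=> /eqP; rewrite mulf_eq0 (negbTE n2) /= => /eqP e2.
  move=> /eqP; rewrite mulf_eq0 (negbTE n1) /= => /eqP e1.
  lra.
split=> // [i j|i c Xi].
- have [ij|ij] := eqVneq `|X 0 i| `|X 0 j|; last first.
    by rewrite (abs_ne i j) // (abs_ne j i) 1?eq_sym // !mulr0.
  have [Xi|Xi] := eqVneq (X 0 i) 0.
    have -> : X 0 j = 0 by apply/eqP; rewrite -normr_eq0 -ij Xi normr0.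
    by rewrite Xi sgr0 !mul0r.
  have Xi2 : X 0 i + X 0 i != 0 by rewrite -mulr2n mulrn_eq0.
  move/eqP: ij; rewrite eqr_norm2 => /orP[] /eqP Xij.
    have := h2 i j; rewrite -Xij => /eqP; rewrite mulf_eq0 (negbTE Xi2) /= subr_eq0.
    by move=> /eqP ->.
  have Xj : X 0 j = - X 0 i by rewrite Xij opprK.
  have := h1 i j; rewrite Xj opprK => /eqP; rewrite mulf_eq0 (negbTE Xi2) /= addr_eq0.
  by move=> /eqP ->; rewrite sgrN mulrN mulNr.
- by have /eqP := h3 i c; rewrite mulf_eq0 (negbTE Xi) /= => /eqP.
Qed.

(** * The space p, its subspaces [VZ] and the adjoint action *)

Lemma pmx_lin (R : realType) (p q : nat) (c : R) (B B' : 'M[R]_(p, q)) :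
  pmx (c *: B + B') = c *: pmx B + pmx B'.
Proof.
by rewrite /pmx scale_block_mx add_block_mx !scaler0 !addr0 linearD linearZ.
Qed.

Lemma pmx0 (R : realType) (p q : nat) : pmx (0 : 'M[R]_(p, q)) = 0.
Proof. by rewrite /pmx trmx0 block_mx0. Qed.

Lemma pmx_sum (R : realType) (p q : nat) (I : finType) (c : I -> R)
    (g : I -> 'M[R]_(p, q)) :
  pmx (\sum_t c t *: g t) = \sum_t c t *: pmx (g t).
Proof.
apply: (big_rec2 (fun x y => pmx x = y)); first exact: pmx0.
by move=> t x y _ <-; rewrite pmx_lin.
Qed.

Lemma VZ_generator_in (R : realType) (p d : nat) (X : 'rV[R]_p) t :
  VZ (p + d) X (pmx (VZ_generator X t)).
Proof.
have scale c B : (c != 0 -> VZ (p + d) X (pmx B)) -> VZ (p + d) X (pmx (c *: B)).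
  have [-> _|c0 /(_ isT) h] := eqVneq c 0.
    by rewrite scale0r pmx0; exact: lin_span0.
  rewrite -[_ *: _]addr0 pmx_lin pmx0; apply: lin_span_lincomb => //; exact: lin_span0.
case: t => [[[i j] b]|[i c]] /=; apply: scale => h.
  by apply: VZ_pair => //; case: b {h}; [right|left]; rewrite ?expr1 ?expr0.
exact: VZ_single.
Qed.

(** For [W] in the Lie algebra the diagonal blocks are antisymmetric and the other two are
    transposes of each other, so [W + W^T] lies in p. *)
Lemma VZ_sub_pspace (R : realType) (p q : nat) (X : 'rV[R]_p) U :
  VZ q X U -> pspace R p q U.
Proof.
move=> [s hs Us]; rewrite (@coord_span _ _ _ (in_tuple s) U Us).
apply: (big_ind (fun v => pspace R p q v)).
- by exists 0 => //; exact: pmx0.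
- by move=> _ _ [B _ <-] [B' _ <-]; exists (1 *: B + B') => //; rewrite pmx_lin scale1r.
move=> i _; have /hs[alpha [W [_ _ [soW _] ->]]] : s`_i \in s by exact: mem_nth.
suff [B ->] : exists B, W - theta W = pmx B.
  by exists (coord (in_tuple s) i U *: B + 0) => //; rewrite pmx_lin pmx0 addr0.
move: soW; rewrite /so /= /theta opprK -[W]submxK.
move: (ulsubmx W) (ursubmx W) (dlsubmx W) (drsubmx W) => a b c e.
rewrite tr_block_mx /Ipq !mulmx_block.
rewrite !mulmx0 !mul0mx !mulmxN !mulNmx !mulmx1 !mul1mx !addr0 !add0r.
rewrite !add_block_mx -(block_mx0 R p q p q) => /eq_block_mx[ha hb _ he].
have cb : c^T = b by apply/eqP; rewrite -subr_eq0 hb.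
exists (b + b); rewrite /pmx linearD /= -cb trmxK; congr block_mx.
  by apply: oppr_inj; rewrite oppr0 opprD addrC.
by rewrite addrC.
Qed.

Lemma Ad_pmx (R : realType) (p q : nat) (A : 'M[R]_p) (D : 'M[R]_q)
    (B : 'M[R]_(p, q)) :
  A^T *m A = 1%:M -> D^T *m D = 1%:M ->
  Ad (block_mx A 0 0 D) (pmx B) = pmx (A *m B *m D^T).
Proof.
move=> AA DD.
have AA' : A *m A^T = 1%:M by exact: mulmx1C.
have DD' : D *m D^T = 1%:M by exact: mulmx1C.
have kk : block_mx A 0 0 D *m block_mx A^T 0 0 D^T = 1%:M.
  by rewrite mulmx_block !mulmx0 !mul0mx !addr0 !add0r AA' DD' -scalar_mx_block.
rewrite /Ad; have -> : invmx (block_mx A 0 0 D) = block_mx A^T 0 0 D^T.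
  have [ku _] := mulmx1_unit kk.
  by rewrite -[RHS]mul1mx -(mulVmx ku) -mulmxA kk mulmx1.
rewrite /pmx !mulmx_block !mulmx0 !mul0mx !addr0 !add0r !trmx_mul trmxK.
by rewrite !mul0mx mulmxA.
Qed.

Theorem theorem13 (R : realType) (p q : nat) (hp : (1 <= p)%N) (hpq : (p < q)%N)
    (X Y : 'rV[R]_p) (s t : seq nat) (u v : nat)
    (hX : configuration X = (s, u)) (hY : configuration Y = (t, v))
    (hel : eligible p (s, u) (t, v)) :
  exists2 k : 'M[R]_(p + q), Kpq k &
    set_add (VZ q X) [set Ad k W | W in VZ q Y] = pspace R p q.
Proof.
have [d qE] : exists d, q = (p + d.+1)%N by exists (q - p).-1; lia.
subst q => {hpq}.
move: hel; rewrite /eligible /max_conf /= => hel.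
have uX := configuration_zeros hX; have vY := configuration_zeros hY.
have [|||A0 [D0 [AA0 DD0 key0]]] := @transversal_exists R p d X Y hp.
(* Keeping one term of each maximum in [hel] bounds [2u + 2v], [s_i + 2v] and [2u + t_j] by [2p]. *)
- by rewrite uX vY; lia.
- by move=> i /(configuration_class hX); rewrite vY; lia.
- by move=> i /(configuration_class hY); rewrite uX; lia.
have [A [D [SOA SOD key]]] := transversal_SO hp AA0 DD0 key0.
have [AA _] := SOA; have [DD _] := SOD.
exists (block_mx A 0 0 D); first by exists A, D.
apply/seteqP; split=> [_ [U /VZ_sub_pspace[B _ <-] [_ [W /VZ_sub_pspace[C _ <-] <-] <-]]|].
  exists (1 *: B + A *m C *m D^T) => //.
  by rewrite pmx_lin scale1r Ad_pmx.
move=> _ [B _ <-].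
pose g (j : _ + _) := match j with
  | inl i => VZ_generator X i
  | inr i => A *m VZ_generator Y i *m D^T
  end.
have [C hC|c ->] := @spanning_of_orthogonal R _ _ _ g _ B.
  apply: key; apply: centralizes_of_orthogonal => i.
    exact: hC (inl i).
  (* By cyclicity of the trace, pairing [B] with [A *m g *m D^T] is pairing [A^T *m B *m D] with
     [g]. *)
  have := hC (inr i); rewrite /= !trmx_mul trmxK => e.
  by rewrite -!mulmxA mxtrace_mulC -!mulmxA.
rewrite big_sumType /= -[X in X + _]scale1r pmx_lin scale1r.
exists (pmx (\sum_i c (inl i) *: VZ_generator X i)).
  by rewrite pmx_sum; apply: lin_span_sum => i; exact: VZ_generator_in.
exists (pmx (\sum_i c (inr i) *: (A *m VZ_generator Y i *m D^T))) => //.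
exists (pmx (\sum_i c (inr i) *: VZ_generator Y i)).
  by rewrite pmx_sum; apply: lin_span_sum => i; exact: VZ_generator_in.
rewrite Ad_pmx // mulmx_sumr mulmx_suml; congr pmx.
by apply: eq_bigr => i _; rewrite -scalemxAr -scalemxAl.
Qed.
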